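(* Let $G$ be a simple connected graph on $n$ vertices with clique number $\omega\ge 2$ and Wiener index $W$. Let $G_1,\dots,G_k$ be all the cliques of $G$ of order $\omega$, and let $s_i=\sum_{v_j\in V(G_i)}D_j$ for $1\le i\le k$. Then (i) if $\omega=n$, then $S_{\mathcal{Q}}(G)=n$; (ii) if $2\le\omega\le n-1$, then $$S_{\mathcal{Q}}(G)\ge \max_{1\le i\le k}\frac{\sqrt{a_i^{2}-4b_i(n-\omega)\omega}}{(n-\omega)\omega},$$ where $a_i=n\omega(1-\omega)+4\omega(s_i-W)-ns_i$ and $b_i=4W\omega(\omega-1)+4s_i(W-s_i)$.
   Context: $G$ has vertex set $\{v_1,\dots,v_n\}$; $d_G$ is the graph distance; $\mathcal{D}(G)=(d_G(v_i,v_j))$. $D_j=\sum_{l\ne j}d_G(v_j,v_l)$ is the transmission of $v_j$, $Tr(G)=\mathrm{diag}(D_1,\dots,D_n)$, $\mathcal{Q}(G)=Tr(G)+\mathcal{D}(G)$. $W=\sum_{i<j}d_G(v_i,v_j)$ is the Wiener index. A clique is a complete subgraph; the clique number is the largest order of a clique. $S_{\mathcal{Q}}(G)$ is the largest eigenvalue of $\mathcal{Q}(G)$ minus the least eigenvalue of $\mathcal{Q}(G)$. *)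

(* Defs.v *)
From HB Require Import structures.
From mathcomp Require Import all_boot all_order all_algebra.
From mathcomp Require Import classical_sets reals.
Set Implicit Arguments. Unset Strict Implicit. Unset Printing Implicit Defensive.
Import Order.TTheory GRing.Theory Num.Theory.

Definition simple_graph (n : nat) (e : rel 'I_n) : Prop :=
  symmetric e /\ irreflexive e.

Definition connected_graph (n : nat) (e : rel 'I_n) : Prop :=
  forall x y : 'I_n, connect e x y.

Fixpoint reach (n : nat) (e : rel 'I_n) (k : nat) (x y : 'I_n) : bool :=
  match k with
  | 0 => x == y
  | k'.+1 => reach e k' x y || [exists z, reach e k' x z && e z y]
  end.

(* graph distance: least k with a walk of length k (for connected graphs
   it is < n) *)
Definition gdist (n : nat) (e : rel 'I_n) (x y : 'I_n) : nat :=
  find (fun k => reach e k x y) (iota 0 n).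

Definition transmission (n : nat) (e : rel 'I_n) (j : 'I_n) : nat :=
  \sum_(l : 'I_n | l != j) gdist e j l.

Definition wiener (n : nat) (e : rel 'I_n) : nat :=
  \sum_(i : 'I_n) \sum_(j : 'I_n | i < j) gdist e i j.

Definition is_clique (n : nat) (e : rel 'I_n) (A : {set 'I_n}) : bool :=
  [forall x in A, forall y in A, (x != y) ==> e x y].

Definition clique_number (n : nat) (e : rel 'I_n) : nat :=
  \max_(A : {set 'I_n} | is_clique e A) #|A|.

Local Open Scope ring_scope.

Definition distance_matrix (R : realType) (n : nat) (e : rel 'I_n) : 'M[R]_n :=
  \matrix_(i, j) (gdist e i j)%:R.

Definition trans_matrix (R : realType) (n : nat) (e : rel 'I_n) : 'M[R]_n :=
  diag_mx (\row_j (transmission e j)%:R).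

Definition Qmatrix (R : realType) (n : nat) (e : rel 'I_n) : 'M[R]_n :=
  trans_matrix R e + distance_matrix R e.

(* S_Q(G): largest eigenvalue minus least eigenvalue of Q(G); the set of
   (real) eigenvalues is finite and nonempty for the real symmetric Q(G),
   so sup/inf are its max/min. *)
Definition spreadQ (R : realType) (n : nat) (e : rel 'I_n) : R :=
  sup [set a : R | eigenvalue (Qmatrix R e) a]
  - inf [set a : R | eigenvalue (Qmatrix R e) a].

(* Main.v *)
Require Import Defs.
From HB Require Import structures.
From mathcomp Require Import all_boot all_order all_algebra.
From mathcomp Require Import classical_sets reals.
From mathcomp Require Import complex lra ring.
Import Order.TTheory GRing.Theory Num.Theory.
Local Open Scope ring_scope.
Set Implicit Arguments.
Unset Strict Implicit.
Unset Printing Implicit Defensive.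

(** Let A be a clique of order w and consider the vectors x = u 1_A + v 1_B,
    B being the complement of A. On their span the quadratic form of Q(G) is
    al u^2 + 2 be u v + ga v^2, where al = s + w (w - 1), al + be = 2 s and
    al + 2 be + ga = 4 W, while |x|^2 = w u^2 + (n - w) v^2. By the spectral
    theorem the forms lam |x|^2 - x Q x^T and x Q x^T - mu |x|^2 are nonnegative
    for the extreme eigenvalues lam and mu, so their discriminants in (u, v) have
    a sign; this says that the interval [mu, lam] contains both eigenvalues of
    the quotient matrix of Q(G) for the partition {A, B}, and the square root in
    the statement, divided by (n - w) w, is their difference. When w = n,
    Q(G) = (n - 2) I + J has the eigenvalues n - 2 and 2 n - 2. *)

(** * Spectral theorem for real symmetric matrices *)

Local Open Scope sesquilinear_scope.

(** Over the complex numbers [M] is Hermitian, hence unitarily diagonalizable. The [y i] are the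
    squared moduli of the coordinates of [x] in the eigenbasis; being real, they make Rayleigh
    quotients weighted means of the [d i] without a real eigenbasis. *)
Lemma real_symmetric_spectral (R : rcfType) (n : nat) (M : 'M[R]_n) :
  M^T = M ->
  exists2 d : 'I_n -> R, forall i, eigenvalue M (d i) &
    forall x : 'rV[R]_n, exists y : 'I_n -> R,
      [/\ forall i, 0 <= y i,
          (x *m x^T) 0 0 = \sum_i y i &
          (x *m M *m x^T) 0 0 = \sum_i d i * y i].
Proof.
move=> symM; pose c := real_complex R; pose A := map_mx c M.
have herA : A \is hermsymmx.
  apply: realsym_hermsym.
    apply/is_hermitianmxP.
    by rewrite expr0 scale1r map_mx_id // /A map_trmx symM.
  by apply/mxOverP => i j; rewrite mxE; apply/complex_realP; exists (M i j).
have norA := hermitian_normalmx herA.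
have /orthomx_spectralP AE := norA.
pose P := spectralmx A; pose D := spectral_diag A.
have unitP : P \is unitarymx := spectral_unitarymx A.
have realD i : D 0 i = c (complex.Re (D 0 i)).
  have /mxOverP/(_ 0 i) := hermitian_spectral_diag_real herA.
  by move=> /RRe_real/esym.
exists (fun i => complex.Re (D 0 i)) => [i|x].
  suff : eigenvalue A (D 0 i) by rewrite realD eigenvalue_map.
  (* The rows of [P] are eigenvectors; none is zero because [P] is invertible. *)
  apply/eigenvalueP; exists (row i P).
    rewrite -row_mul [X in P *m X]AE -/P -/D !mulmxA mulmxV ?spectral_unit // mul1mx.
    by rewrite row_mul row_diag_mx -scalemxAl -rowE.
  have := mxrank_unitary unitP; rewrite -/(row_free P).
  move=> rP; apply/eqP => r0.
  have : row_free P by rewrite /row_free rP.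
  move=> /row_freeP [B PB]; have := congr1 (row i) PB.
  rewrite row_mul r0 mul0mx => /rowP/(_ i); rewrite !mxE eqxx => /eqP.
  by rewrite eq_sym oner_eq0.
pose z : 'rV_n := map_mx c x *m P ^t*.
pose y i := complex.Re (z 0 i * (z 0 i)^*).
have cy i : c (y i) = z 0 i * (z 0 i)^*.
  by apply: RRe_real; rewrite ger0_real // mul_conjC_ge0.
have xt : z ^t* = P *m map_mx c x^T.
  rewrite /z trmx_mul map_mxM /= trmxCK; congr (_ *m _).
  apply/matrixP => i j; rewrite !mxE; exact: conjc_real.
exists y; split=> [i||].
- have := mul_conjC_ge0 (z 0 i); rewrite -cy; by rewrite ler0c.
- apply: (fmorph_inj c); rewrite rmorph_sum /=.
  transitivity ((z *m z ^t*) 0 0).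
    rewrite xt /z mulmxA -(mulmxA _ _ P) -invmx_unitary // mulVmx ?unitarymx_unit//.
    by rewrite mulmx1 -map_mxM [RHS]mxE.
  by rewrite mxE; apply: eq_bigr => i _; rewrite [RHS]cy !mxE.
- apply: (fmorph_inj c); rewrite rmorph_sum /=.
  transitivity ((z *m diag_mx D *m z ^t*) 0 0).
    rewrite xt /z -invmx_unitary //.
    rewrite !mulmxA -(mulmxA _ (invmx P)) -(mulmxA _ _ P) -AE /A.
    by rewrite -!map_mxM [RHS]mxE.
  rewrite mxE; apply: eq_bigr => i _; rewrite rmorphM [X in _ = _ * X]cy -[X in _ = X * _]realD.
  by rewrite mul_mx_diag !mxE mulrAC mulrC mulrA.
Qed.

(** * Rayleigh bounds for the extreme eigenvalues *)

Section Rayleigh.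
Variables (R : realType) (n : nat) (M : 'M[R]_n) (symM : M^T = M).

Local Notation spec := ([set a : R | eigenvalue M a]%classic).

Lemma dotmx_gt0 (u : 'rV[R]_n) : u != 0 -> 0 < (u *m u^T) 0 0.
Proof.
move=> u0; have E : (u *m u^T) 0 0 = \sum_i u 0 i ^+ 2.
  by rewrite mxE; apply: eq_bigr => i _; rewrite mxE expr2.
have sq i : 0 <= u 0 i ^+ 2 by exact: sqr_ge0.
rewrite lt_neqAle E sumr_ge0 // andbT eq_sym psumr_neq0 //.
have /rV0Pn[i ui] := u0; apply/hasP; exists i; first exact: mem_index_enum.
by rewrite /= lt_neqAle sq andbT eq_sym sqrf_eq0.
Qed.

(** Needed for [sup] and [inf] to bound the spectrum. An eigenvector for [a] gives a Σ y_i = Σ d_i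
    y_i with Σ y_i > 0, hence |a| ≤ Σ |d_i|. *)
Lemma eigenvalues_bounded : exists B : R, forall a, eigenvalue M a -> `|a| <= B.
Proof.
have [d _ dP] := real_symmetric_spectral symM.
exists (\sum_i `|d i|) => a /eigenvalueP [u uM /dotmx_gt0 u0].
have [y [y0 uu]] := dP u; rewrite uM -scalemxAl mxE uu => E.
move: u0; rewrite uu => u0; rewrite -(ler_pM2r u0).
rewrite -[X in _ * X <= _]gtr0_norm // -normrM E.
apply: le_trans (ler_norm_sum _ _ _) _; rewrite mulr_suml ler_sum // => i _.
rewrite normrM ler_wpM2l // ger0_norm // (bigD1 i) //= lerDl sumr_ge0 //.
Qed.

Lemma rayleigh_le_sup_eigenvalue (x : 'rV[R]_n) :
  (x *m M *m x^T) 0 0 <= sup spec * (x *m x^T) 0 0.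
Proof.
have [d dM /(_ x) [y [y0 -> ->]]] := real_symmetric_spectral symM.
rewrite mulr_sumr ler_sum // => i _; rewrite ler_wpM2r //.
apply: ub_le_sup; last exact: dM.
have [B MB] := eigenvalues_bounded; exists B => a /MB.
by apply: le_trans; exact: ler_norm.
Qed.

Lemma inf_eigenvalue_le_rayleigh (x : 'rV[R]_n) :
  inf spec * (x *m x^T) 0 0 <= (x *m M *m x^T) 0 0.
Proof.
have [d dM /(_ x) [y [y0 -> ->]]] := real_symmetric_spectral symM.
rewrite mulr_sumr ler_sum // => i _; rewrite ler_wpM2r //.
apply: ge_inf; last exact: dM.
have [B MB] := eigenvalues_bounded; exists (- B) => a /MB.
by rewrite ler_norml => /andP[].
Qed.

End Rayleigh.

(** * Binary quadratic forms and discriminants *)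

Lemma nonneg_form_discr (R : realFieldType) (a b c : R) :
  (forall u v, 0 <= a * u ^+ 2 - 2 * b * u * v + c * v ^+ 2) ->
  [/\ 0 <= a, 0 <= c & b ^+ 2 <= a * c].
Proof.
move=> H; have a0 := H 1 0; have c0 := H 0 1.
rewrite expr1n expr0n /= !mulr0 !mulr1 ?subr0 ?addr0 ?add0r in a0 c0.
split=> //.
have [cp|] := ltP 0 c.
  (* For fixed [u] the minimum lies at v = b u / c; scaling by [c] avoids the division. *)
  have := H c b.
  have -> : a * c ^+ 2 - 2 * b * c * b + c * b ^+ 2 = c * (a * c - b ^+ 2) by ring.
  by rewrite pmulr_rge0 // subr_ge0.
move=> c0'; have {c0 c0'} cE : c = 0 by lra.
(* At this point the form is -(a + 2) b², which forces b = 0. *)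
have := H b (a + 1); rewrite cE; nra.
Qed.

(** This places [l] at or above the larger root of (t - p)(t - q) = r. With X = l - p and Y = l - q,
    it follows from (X + Y)² = (X - Y)² + 4XY. *)
Lemma sum_ge_discr (R : rcfType) (l p q r : R) : 0 <= l - p -> 0 <= l - q ->
  r <= (l - p) * (l - q) -> Num.sqrt ((p - q) ^+ 2 + 4 * r) <= 2 * l - p - q.
Proof.
move=> lp lq h; have s0 : 0 <= 2 * l - p - q by lra.
rewrite -(ger0_norm s0) -sqrtr_sqr ler_wsqrtr //; nra.
Qed.

(** * Graph distance, transmissions and the Wiener index *)

Section GraphDistance.
Variables (n : nat) (e : rel 'I_n).

(** Explicit walks can be reversed, which the recursion of [reach], growing at the far end only,
    does not show. *)
Lemma reach_path k x y : reach e k x y =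
  [exists p : k.-bseq 'I_n, path e x p && (last x p == y)].
Proof.
elim: k y => [|k IH] y /=.
  apply/eqP/existsP => [->|[p]]; first by exists [bseq]; rewrite /= eqxx.
  by rewrite bseq0 /= => /eqP.
rewrite IH; apply/orP/existsP.
- case=> [/existsP[p pP]|/existsP[z /andP[]]].
    by exists (widen_bseq (leqnSn k) p).
  rewrite IH => /existsP[p /andP[pp /eqP lp] ezy].
  exists (rcons_bseq p y); rewrite /= rcons_path pp lp ezy last_rcons eqxx //.
- case=> -[p /= sp] /andP[].
  case/lastP: p sp => [|p z] sp /=.
    move=> _ /eqP <-; left; apply/existsP; exists [bseq]; by rewrite /= eqxx.
  rewrite rcons_path last_rcons => /andP[pp ez] /eqP <-; right.
  apply/existsP; exists (last x p); rewrite ez andbT IH.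
  rewrite size_rcons ltnS in sp.
  by apply/existsP; exists (Bseq sp); rewrite pp /= eqxx.
Qed.

Hypothesis sym_e : symmetric e.

Lemma reach_sym k x y : reach e k x y = reach e k y x.
Proof.
suff H x' y' : reach e k x' y' -> reach e k y' x' by apply/idP/idP; exact: H.
rewrite !reach_path => /existsP[p /andP[pp /eqP lp]].
(* The walk back from y' omits its own start, the last vertex of [p], and ends in x'. *)
have sz : (size (rev (belast x' p)) <= k)%N.
  by rewrite size_rev size_belast size_bseq.
apply/existsP; exists (Bseq sz) => /=; rewrite -lp rev_path.
rewrite (eq_path (e' := e)) ?pp /=; last by move=> a b; rewrite /= sym_e.
case: (val p) => [|a s] /=; first by rewrite eqxx.
by rewrite rev_cons last_rcons eqxx.
Qed.

Lemma gdist_sym x y : gdist e x y = gdist e y x.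
Proof. by apply: eq_find => k; exact: reach_sym. Qed.

Lemma gdistxx x : gdist e x x = 0%N.
Proof. by case: n e x => [|m] e' x; [case: x | rewrite /gdist /= eqxx]. Qed.

Lemma gdist_adj x y : x != y -> e x y -> gdist e x y = 1%N.
Proof.
(* The search range [iota 0 n] contains 1 only if n > 1. *)
move=> xy exy; have : (1 < n)%N.
  rewrite -[n]card_ord; apply/card_gt1P; exists x, y; split=> //.
rewrite /gdist; case: n e x y xy exy => [|[|m]] // e' x y xy exy _ /=.
rewrite (negbTE xy) /= ifT //.
by apply/existsP; exists x; rewrite eqxx.
Qed.

Lemma transmissionE j : transmission e j = (\sum_l gdist e j l)%N.
Proof. by rewrite [RHS](bigD1 j) //= gdistxx. Qed.

Lemma sum_transmission : (\sum_j transmission e j = 2 * wiener e)%N.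
Proof.
rewrite mul2n -addnn {2}/wiener.
have -> : (\sum_(i < n) \sum_(j < n | (i < j)%N) gdist e i j =
           \sum_(i < n) \sum_(j < n | (j < i)%N) gdist e i j)%N.
  rewrite (exchange_big_dep xpredT) //=; apply: eq_bigr => i _.
  by apply: eq_bigr => j _; rewrite gdist_sym.
rewrite /wiener -big_split /=; apply: eq_bigr => i _.
rewrite /transmission (bigID (fun j : 'I_n => (i < j)%N)) /=.
congr (_ + _)%N; apply: eq_bigl => j.
  by case: (ltngtP i j) => [h|h|h]; rewrite ?andbF ?andbT // -(inj_eq val_inj) /= gtn_eqF.
by rewrite -leqNgt ltn_neqAle.
Qed.

Lemma clique_sum_gdist (A : {set 'I_n}) i : is_clique e A -> i \in A ->
  (\sum_(j in A) gdist e i j = #|A|.-1)%N.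
Proof.
move=> /'forall_in_forall_inP cA iA; rewrite (bigD1 i) //= gdistxx add0n.
transitivity (\sum_(j in A | j != i) 1)%N.
  apply: eq_bigr => j /andP[jA ji]; have := cA i iA j jA.
  by rewrite eq_sym ji /= => eij; rewrite gdist_adj // eq_sym.
rewrite sum1_card (cardsD1 i A) iA /=.
by apply: eq_card => j; rewrite !inE andbC.
Qed.

(** * Row and block sums of Q(G) *)

Section Qmatrix.
Variable R : realType.
Local Notation Q := (Qmatrix R e).

Lemma QmatrixE i j :
  Q i j = (transmission e i)%:R *+ (i == j) + (gdist e i j)%:R.
Proof. by rewrite !mxE; case: eqP => [->|]. Qed.

Lemma Qmatrix_sym : Q^T = Q.
Proof.
apply/matrixP => i j; rewrite mxE !QmatrixE gdist_sym eq_sym.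
by case: eqP => [->|].
Qed.

Lemma Qmatrix_row_sum i : \sum_j Q i j = 2 * (transmission e i)%:R.
Proof.
rewrite (eq_bigr _ (fun j _ => QmatrixE i j)) big_split /= -natr_sum -transmissionE.
rewrite (bigD1 i) //= eqxx big1 ?addr0 => [|j ji]; last by rewrite eq_sym (negbTE ji).
by rewrite mulr1n mulr_natl mulr2n.
Qed.

Lemma Qmatrix_sum : \sum_i \sum_j Q i j = 4 * (wiener e)%:R.
Proof.
rewrite (eq_bigr _ (fun i _ => Qmatrix_row_sum i)) -mulr_sumr -natr_sum.
rewrite sum_transmission natrM; ring.
Qed.

Lemma Qmatrix_clique_sum (A : {set 'I_n}) : is_clique e A ->
  \sum_(i in A) \sum_(j in A) Q i j =
  (\sum_(j in A) transmission e j)%:R + #|A|%:R * (#|A|%:R - 1).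
Proof.
move=> cA; rewrite natr_sum.
have -> : #|A|%:R * (#|A|%:R - 1) = \sum_(i in A) (#|A|%:R - 1) :> R.
  by rewrite sumr_const mulr_natl.
rewrite -big_split; apply: eq_bigr => i iA /=.
rewrite (eq_bigr _ (fun j _ => QmatrixE i j)) big_split /=; congr (_ + _).
  rewrite (bigD1 i) //= eqxx big1 ?addr0 // => j /andP[_ ji].
  by rewrite eq_sym (negbTE ji).
(* Since [i] lies in [A], the predecessor of #|A| is a genuine subtraction. *)
rewrite -natr_sum clique_sum_gdist // (cardsD1 i) iA add1n /=.
by rewrite -natr1 addrK.
Qed.

End Qmatrix.
End GraphDistance.

(** * Vectors constant on [A] and on its complement *)

Section TwoBlock.
Variables (R : comPzRingType) (n : nat) (A : {set 'I_n}) (u v : R).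
Definition two_block : 'rV[R]_n := \row_j (if j \in A then u else v).

Lemma two_block_norm :
  (two_block *m two_block^T) 0 0 = #|A|%:R * u ^+ 2 + (n%:R - #|A|%:R) * v ^+ 2.
Proof.
rewrite mxE (bigID (mem A)) /=; congr (_ + _).
  rewrite (eq_bigr (fun=> u ^+ 2)) => [|i iA]; last by rewrite !mxE iA expr2.
  by rewrite sumr_const mulr_natl.
rewrite (eq_bigr (fun=> v ^+ 2)) => [|i /negbTE iA]; last by rewrite !mxE iA expr2.
have -> : n%:R = #|A|%:R + #|~: A|%:R :> R.
  by rewrite -natrD cardsC card_ord.
rewrite addrAC subrr add0r mulr_natl -sumr_const.
by apply: eq_bigl => i; rewrite inE.
Qed.

(** By symmetry the two mixed blocks have the same sum, t - p; the block of the complement takes the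
    rest of the total. *)
Lemma two_block_form (M : 'M[R]_n) (p t : R) : M^T = M ->
  \sum_(i in A) \sum_(j in A) M i j = p ->
  \sum_(i in A) \sum_j M i j = t ->
  (two_block *m M *m two_block^T) 0 0 =
  p * u ^+ 2 + 2 * (t - p) * u * v
    + (\sum_i \sum_j M i j - 2 * t + p) * v ^+ 2.
Proof.
move=> symM pE tE.
pose q := \sum_(i in A) \sum_(j | j \notin A) M i j.
pose r := \sum_(i | i \notin A) \sum_(j | j \notin A) M i j.
have q' : \sum_(i | i \notin A) \sum_(j in A) M i j = q.
  rewrite /q exchange_big /=; apply: eq_bigr => i _; apply: eq_bigr => j _.
  by rewrite -[in LHS]symM mxE.
have tpq : t = p + q.
  rewrite -tE -pE -big_split /=; apply: eq_bigr => i _.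
  by rewrite (bigID (mem A)).
have -> : \sum_i \sum_j M i j = p + q + (q + r).
  rewrite (bigID (mem A)) /= tE -tpq; congr (_ + _).
  rewrite -q' -big_split /=; apply: eq_bigr => i _.
  by rewrite (bigID (mem A)).
rewrite tpq.
transitivity (p * u ^+ 2 + q * (u * v) + (q * (u * v) + r * v ^+ 2)); last by ring.
have -> : (two_block *m M *m two_block^T) 0 0 =
   \sum_i \sum_j two_block 0 i * M i j * two_block 0 j.
  rewrite mxE exchange_big /=; apply: eq_bigr => i _.
  by rewrite !mxE mulr_suml; apply: eq_bigr => j _; rewrite !mxE.
rewrite (bigID (mem A)) /= -{2}q' -pE /r /q; congr (_ + _);
  rewrite !mulr_suml -big_split; apply: eq_bigr => i iA /=;
  rewrite (bigID (mem A)) /=; congr (_ + _); rewrite mulr_suml;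
  apply: eq_bigr => j jA; rewrite !mxE ?(negbTE iA) ?(negbTE jA) ?iA ?jA; ring.
Qed.

End TwoBlock.

(** * The spectrum of cI + J *)

Section ScalarPlusOnes.
Variables (R : realType) (n : nat) (c : R).
Hypothesis n2 : (1 < n)%N.
Local Notation M := (c%:M + const_mx 1 : 'M[R]_n).

Lemma mul_scalar_plus_ones (u : 'rV[R]_n) :
  u *m M = c *: u + const_mx (\sum_i u 0 i).
Proof.
rewrite mulmxDr mul_mx_scalar; congr (_ + _); apply/rowP => j.
by rewrite !mxE; apply: eq_bigr => i _; rewrite mxE mulr1.
Qed.

(** If a ≠ c, then (a - c) u_j = Σ u_i for all j; summing over j gives a - c = n. Conversely, a
    difference of two unit vectors, available as n > 1, has eigenvalue c, and the all-ones vector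
    has c + n. *)
Lemma eigenvalue_scalar_plus_ones a :
  eigenvalue M a = (a == c) || (a == c + n%:R).
Proof.
apply/eigenvalueP/orP => [[u]|].
  rewrite mul_scalar_plus_ones => /rowP uE u0.
  have [->|ac] := eqVneq a c; [by left | right].
  set S := \sum_i u 0 i in uE.
  have {}uE j : (a - c) * u 0 j = S.
    by have := uE j; rewrite !mxE mulrBl => <-; rewrite addrAC subrr add0r.
  have S0 : S != 0.
    have /rV0Pn[j uj] := u0.
    by rewrite -(uE j) mulf_neq0 // subr_eq0.
  have : (a - c) * S = n%:R * S.
    by rewrite {1}/S mulr_sumr (eq_bigr _ (fun j _ => uE j)) sumr_const card_ord mulr_natl.
  by move/(mulIf S0)/eqP; rewrite subr_eq addrC.
case=> /eqP ->.
  pose i0 : 'I_n := Ordinal (ltnW n2); pose i1 := Ordinal n2.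
  exists (delta_mx 0 i0 - delta_mx 0 i1).
    rewrite mul_scalar_plus_ones; set t := \sum_i _.
    suff -> : t = 0 by apply/rowP => k; rewrite !mxE addr0.
    rewrite /t (bigD1 i0) //= (bigD1 i1) //= big1 ?addr0 => [|j /andP[/negbTE h /negbTE h']].
      by rewrite !mxE /= subr0 sub0r subrr.
    by rewrite !mxE h h' subr0.
  by apply/rV0Pn; exists i0; rewrite !mxE /= subr0 oner_eq0.
exists (const_mx 1).
  rewrite mul_scalar_plus_ones scalerDl; congr (_ + _).
  apply/rowP => j; rewrite !mxE (eq_bigr (fun=> 1)) ?sumr_const ?card_ord ?mulr1 //.
  by move=> i _; rewrite mxE.
by apply/rV0Pn; exists (Ordinal n2); rewrite mxE oner_eq0.
Qed.

Lemma spread_scalar_plus_ones :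
  sup [set a : R | eigenvalue M a]%classic
  - inf [set a : R | eigenvalue M a]%classic = n%:R.
Proof.
set E := [set a : R | eigenvalue M a]%classic.
have n0 : 0 <= n%:R :> R by [].
have Ec : E c by rewrite /E /= eigenvalue_scalar_plus_ones eqxx.
have Ecn : E (c + n%:R) by rewrite /E /= eigenvalue_scalar_plus_ones eqxx orbT.
have ubE : ubound E (c + n%:R).
  by move=> a; rewrite /E /= eigenvalue_scalar_plus_ones => /orP[] /eqP ->; lra.
have lbE : lbound E c.
  by move=> a; rewrite /E /= eigenvalue_scalar_plus_ones => /orP[] /eqP ->; lra.
have -> : sup E = c + n%:R.
  by apply/eqP; rewrite eq_le ge_sup ?ub_le_sup //; exists (c + n%:R).
have -> : inf E = c.
  by apply/eqP; rewrite eq_le ge_inf ?lb_le_inf //; exists c.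
by rewrite addrAC subrr add0r.
Qed.

End ScalarPlusOnes.

(** * Complete graphs, and the bound from a single clique *)

Lemma clique_number_witness (n : nat) (e : rel 'I_n) :
  exists2 A, is_clique e A & #|A| = clique_number e.
Proof.
(* The maximum is attained because the empty set is a clique. *)
have /eq_bigmax_cond : (0 < #|[pred A | is_clique e A]|)%N.
  apply/card_gt0P; exists finset.set0; rewrite inE.
  by apply/'forall_in_forall_inP => x; rewrite inE.
by move=> /(_ (fun A => #|A|)) [A cA AE]; exists A.
Qed.

Lemma Qmatrix_complete (R : realType) (n : nat) (e : rel 'I_n)
    (A : {set 'I_n}) : is_clique e A -> #|A| = n ->
  Qmatrix R e = (n%:R - 2)%:M + const_mx 1.
Proof.
move=> cA An; apply/matrixP => i j; rewrite QmatrixE !mxE.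
have AT : A =i 'I_n.
  by apply/subset_cardP; rewrite ?card_ord // subset_predT.
have tr : transmission e i = n.-1.
  rewrite transmissionE -[in RHS]An -(clique_sum_gdist cA (i := i)) ?AT //.
  by apply: eq_bigl => k; rewrite AT.
case: eqVneq => [<-|ij].
  have n0 : (0 < n)%N := leq_ltn_trans (leq0n i) (ltn_ord i).
  by rewrite gdistxx tr -[X in _ = (X%:R - 2) *+ _ + _](prednK n0) -natr1 !mulr1n; ring.
rewrite !mulr0n !add0r gdist_adj //.
by move: cA => /'forall_in_forall_inP/(_ i _ j); rewrite !AT ij; exact.
Qed.

Lemma spreadQ_ge_clique (R : realType) (n : nat) (e : rel 'I_n)
    (A : {set 'I_n}) : symmetric e -> is_clique e A ->
  (0 < #|A|)%N -> (#|A| < n)%N ->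
  let W : R := (wiener e)%:R in
  let s : R := (\sum_(j in A) transmission e j)%:R in
  let nr : R := n%:R in
  let wr : R := #|A|%:R in
  let a : R := nr * wr * (1 - wr) + 4 * wr * (s - W) - nr * s in
  let b : R := 4 * W * wr * (wr - 1) + 4 * s * (W - s) in
  Num.sqrt (a ^+ 2 - 4 * b * (nr - wr) * wr) / ((nr - wr) * wr)
    <= spreadQ R e.
Proof.
move=> symE cA A0 An; cbv zeta.
set W := (wiener e)%:R; set s := (\sum_(j in A) _)%:R.
set nr := n%:R; set wr := #|A|%:R.
set a := nr * wr * (1 - wr) + _ - _; set b := _ + 4 * s * (W - s).
have symQ := Qmatrix_sym symE R.
have w0 : 0 < wr by rewrite ltr0n.
have m0 : 0 < nr - wr by rewrite subr_gt0 ltr_nat.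
pose al := s + wr * (wr - 1); pose be := 2 * s - al.
pose ga := 4 * W - 2 * (2 * s) + al.
have form u v : let x := two_block A u v in
    (x *m Qmatrix R e *m x^T) 0 0 = al * u ^+ 2 + 2 * be * u * v + ga * v ^+ 2.
  (* Each row of Q(G) sums to twice a transmission, so the rows in [A] sum to 2s. *)
  rewrite /= (two_block_form u v symQ (Qmatrix_clique_sum R cA) (t := 2 * s)).
    by rewrite Qmatrix_sum.
  rewrite (eq_bigr _ (fun i _ => Qmatrix_row_sum e R i)) -mulr_sumr.
  by rewrite /s natr_sum.
have norm u v := two_block_norm A u v : _ = wr * u ^+ 2 + (nr - wr) * v ^+ 2.
set lam := sup [set x : R | eigenvalue (Qmatrix R e) x]%classic.
set mu := inf [set x : R | eigenvalue (Qmatrix R e) x]%classic.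
have [u1 u2 u3] : [/\ 0 <= lam * wr - al, 0 <= lam * (nr - wr) - ga &
    be ^+ 2 <= (lam * wr - al) * (lam * (nr - wr) - ga)].
  apply: nonneg_form_discr => u v.
  have := rayleigh_le_sup_eigenvalue symQ (two_block A u v); rewrite form norm -/lam; lra.
have [l1 l2 l3] : [/\ 0 <= al - mu * wr, 0 <= ga - mu * (nr - wr) &
    (- be) ^+ 2 <= (al - mu * wr) * (ga - mu * (nr - wr))].
  apply: nonneg_form_discr => u v.
  have := inf_eigenvalue_le_rayleigh symQ (two_block A u v); rewrite form norm -/mu; lra.
(* The quotient matrix has diagonal entries p, q and off-diagonal product r, so its eigenvalues are
   the roots of (t - p)(t - q) = r. *)
pose p := al / wr; pose q := ga / (nr - wr).
pose r := be ^+ 2 / (wr * (nr - wr)).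
have wn := lt0r_neq0 w0; have mn := lt0r_neq0 m0.
have up : 2 * lam - p - q >= Num.sqrt ((p - q) ^+ 2 + 4 * r).
  apply: sum_ge_discr.
  - by rewrite subr_ge0 ler_pdivrMr // -subr_ge0.
  - by rewrite subr_ge0 ler_pdivrMr // -subr_ge0.
  - rewrite ler_pdivrMr ?mulr_gt0 //; apply: le_trans u3 _.
    by rewrite le_eqVlt; apply/orP; left; apply/eqP; rewrite /p /q; field; rewrite ?wn ?mn.
(* Negating all quantities turns the lower bound into an instance of the upper one; adding [up] and
   [lo] then cancels p and q. *)
have lo : 2 * (- mu) - (- p) - (- q) >= Num.sqrt ((- p - - q) ^+ 2 + 4 * r).
  apply: sum_ge_discr.
  - by rewrite subr_ge0 lerN2 ler_pdivlMr // -subr_ge0.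
  - by rewrite subr_ge0 lerN2 ler_pdivlMr // -subr_ge0.
  - rewrite ler_pdivrMr ?mulr_gt0 // -(sqrrN be); apply: le_trans l3 _.
    by rewrite le_eqVlt; apply/orP; left; apply/eqP; rewrite /p /q; field; rewrite ?wn ?mn.
have -> : Num.sqrt (a ^+ 2 - 4 * b * (nr - wr) * wr) / ((nr - wr) * wr) =
    Num.sqrt ((p - q) ^+ 2 + 4 * r).
  have d0 : 0 < (nr - wr) * wr by rewrite mulr_gt0.
  (* With d = (n - w)w one has a = -d(p + q) and b = al ga - be² = d(pq - r): the left side is the
     discriminant of d times the characteristic polynomial of the quotient matrix. *)
  have -> : a ^+ 2 - 4 * b * (nr - wr) * wr =
      ((p - q) ^+ 2 + 4 * r) * ((nr - wr) * wr) ^+ 2.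
    by rewrite /p /q /r /a /b /ga /be /al; field; rewrite ?wn ?mn.
  rewrite sqrtrM ?sqrtr_sqr.
    by rewrite (gtr0_norm d0) mulfK // lt0r_neq0.
  by rewrite addr_ge0 ?sqr_ge0 // mulr_ge0 // divr_ge0 ?sqr_ge0 // mulr_ge0 // ltW.
have sqE : (- p - - q) ^+ 2 = (p - q) ^+ 2 by ring.
rewrite sqE in lo; rewrite /spreadQ -/lam -/mu; lra.
Qed.

(** The maximum over the cliques of order w is rendered as a bound for each such clique [A]. *)
Theorem theorem4p6 (R : realType) (n : nat) (e : rel 'I_n) :
  simple_graph e -> connected_graph e -> (2 <= clique_number e)%N ->
  let w := clique_number e in
  let W : R := (wiener e)%:R in
  ((w = n) -> spreadQ R e = n%:R) /\
  ((w <= n.-1)%N ->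
   forall A : {set 'I_n}, is_clique e A -> #|A| = w ->
     let s : R := (\sum_(j in A) transmission e j)%:R in
     let nr : R := n%:R in
     let wr : R := w%:R in
     let a : R := nr * wr * (1 - wr) + 4 * wr * (s - W) - nr * s in
     let b : R := 4 * W * wr * (wr - 1) + 4 * s * (W - s) in
     Num.sqrt (a ^+ 2 - 4 * b * (nr - wr) * wr) / ((nr - wr) * wr)
       <= spreadQ R e).
Proof.
move=> [symE _] _ w2 w W; split=> [wn|wn A cA Aw].
  have [A cA Aw] := clique_number_witness e.
  rewrite /spreadQ (Qmatrix_complete R cA); last by rewrite Aw.
  by apply: spread_scalar_plus_ones; rewrite -wn.
have A0 : (0 < #|A|)%N by rewrite Aw ltnW.
have An : (#|A| < n)%N.
  (* A vertex of [A] gives n > 0, so that w ≤ [n.-1] yields w < n. *)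
  have /card_gt0P[i _] := A0.
  by rewrite Aw (leq_ltn_trans wn) // ltn_predL (leq_ltn_trans _ (ltn_ord i)).
by rewrite -Aw; exact: spreadQ_ge_clique.
Qed.
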